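(* Let $(A,\cdot,d)$ be a differential perm algebra over a field of characteristic $0$. Assume that $A$ satisfies a nontrivial polynomial identity $f\in \mathrm{DerPerm}\langle X\rangle$, where nontrivial means that $f$ is not an element of the right annihilator of the free differential perm algebra, i.e. $f\notin \mathrm{Ann}_R(\mathrm{DerPerm}\langle X\rangle)$. Then there is an integer $m\ge 2$ such that $A$ satisfies the differential polynomial identity $$a_1'a_2'\cdots a_m'=0,$$ i.e. $d(a_1)d(a_2)\cdots d(a_m)=0$ for all $a_1,\dots,a_m\in A$.
   Context: A perm algebra is an associative algebra $(P,\cdot)$ satisfying $(ab)c=(ba)c$ for all $a,b,c$. A differential perm algebra $(P,\cdot,d)$ is a perm algebra with a derivation $d$; write $a'=d(a)$. For a countable set $X=\{x_1,x_2,\dots\}$, $\mathrm{DerPerm}\langle X\rangle$ denotes the free differential perm algebra on $X$ (over the ground field): it is the free perm algebra generated by the symbols $x^{(s)}$ ($x\in X$, $s\ge 0$, $x^{(0)}=x$), with the derivation determined by $d(x^{(s)})=x^{(s+1)}$ and the Leibniz rule. A differential perm algebra $A$ satisfies the identity $f\in\mathrm{DerPerm}\langle X\rangle$ if $f$ is sent to $0$ by every homomorphism of differential perm algebras $\mathrm{DerPerm}\langle X\rangle\to A$ (i.e. $f$ vanishes under every substitution of elements of $A$ for the variables). For a differential perm algebra $B$, $\mathrm{Ann}_R(B):=\{x\in B\mid xB=0\}$. *)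

(* Defs.v *)
From HB Require Import structures.
From mathcomp Require Import all_boot all_order all_algebra.
From mathcomp Require Import boolp.
Set Implicit Arguments.
Unset Strict Implicit.
Unset Printing Implicit Defensive.
Import GRing.Theory.
Local Open Scope ring_scope.
Local Open Scope quotient_scope.

(* Perm algebras are not assumed to be unital, hence they are built on top of *)
(* lmodType and not on one of the ring structures of MathComp.                *)
HB.mixin Record Lmodule_isPermAlgebra (K : fieldType) A of GRing.Lmodule K A := {
  pmul : A -> A -> A;
  pmulDl : forall a b c, pmul (a + b) c = pmul a c + pmul b c;
  pmulDr : forall a b c, pmul a (b + c) = pmul a b + pmul a c;
  pmulZl : forall k a b, pmul (k *: a) b = k *: pmul a b;
  pmulZr : forall k a b, pmul a (k *: b) = k *: pmul a b;
  pmulA : forall a b c, pmul a (pmul b c) = pmul (pmul a b) c;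
  pmulCl : forall a b c, pmul (pmul a b) c = pmul (pmul b a) c
}.

#[short(type="permAlgType")]
HB.structure Definition PermAlgebra (K : fieldType) :=
  {A of GRing.Lmodule K A & Lmodule_isPermAlgebra K A}.

Notation "a ** b" := (pmul a b) (at level 40, left associativity) : ring_scope.

HB.mixin Record PermAlgebra_isDifferential (K : fieldType) A
    of PermAlgebra K A := {
  pderiv : A -> A;
  pderiv_linear : linear pderiv;
  pderivM : forall a b, pderiv (a ** b) = pderiv a ** b + a ** pderiv b
}.

#[short(type="diffPermAlgType")]
HB.structure Definition DiffPermAlgebra (K : fieldType) :=
  {A of PermAlgebra K A & PermAlgebra_isDifferential K A}.

HB.instance Definition _ (K : fieldType) (A : diffPermAlgType K) :=
  GRing.isLinear.Build K A A *:%R pderiv pderiv_linear.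

Record diffPerm_hom (K : fieldType) (A B : diffPermAlgType K) (phi : A -> B)
    : Prop := DiffPermHom {
  dphom_linear : linear phi;
  dphom_mul : {morph phi : a b / a ** b};
  dphom_deriv : {morph phi : a / pderiv a}
}.

Definition annR (K : fieldType) (B : permAlgType K) (x : B) : Prop :=
  forall b : B, x ** b = 0.

(* The value on the empty sequence is irrelevant: there is no unit.           *)
Definition pprod (K : fieldType) (A : permAlgType K) (s : seq A) : A :=
  if s is a :: s' then foldl pmul a s' else 0.

(* The free perm algebra on a type V of generators: formal expressions modulo *)
(* the least congruence containing the axioms of perm algebras.               *)
Inductive pterm (K V : Type) : Type :=
  | PVar of V
  | PZero
  | POpp of pterm K V
  | PAdd of pterm K V & pterm K V
  | PScale of K & pterm K V
  | PMul of pterm K V & pterm K V.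

Arguments PVar {K V} _.
Arguments PZero {K V}.

HB.instance Definition _ (K V : Type) := gen_eqMixin (pterm K V).
HB.instance Definition _ (K V : Type) := gen_choiceMixin (pterm K V).

Inductive pcong (K : fieldType) (V : Type) : pterm K V -> pterm K V -> Prop :=
  | pc_refl s : pcong s s
  | pc_sym s t : pcong s t -> pcong t s
  | pc_trans s t u : pcong s t -> pcong t u -> pcong s u
  | pc_opp s s' : pcong s s' -> pcong (POpp s) (POpp s')
  | pc_add s s' t t' : pcong s s' -> pcong t t' -> pcong (PAdd s t) (PAdd s' t')
  | pc_scale k s s' : pcong s s' -> pcong (PScale k s) (PScale k s')
  | pc_mul s s' t t' : pcong s s' -> pcong t t' -> pcong (PMul s t) (PMul s' t')
  | pc_addA s t u : pcong (PAdd s (PAdd t u)) (PAdd (PAdd s t) u)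
  | pc_addC s t : pcong (PAdd s t) (PAdd t s)
  | pc_add0 s : pcong (PAdd PZero s) s
  | pc_addN s : pcong (PAdd (POpp s) s) PZero
  | pc_scaleA k l s : pcong (PScale k (PScale l s)) (PScale (k * l) s)
  | pc_scale1 s : pcong (PScale 1 s) s
  | pc_scaleDr k s t :
      pcong (PScale k (PAdd s t)) (PAdd (PScale k s) (PScale k t))
  | pc_scaleDl k l s :
      pcong (PScale (k + l) s) (PAdd (PScale k s) (PScale l s))
  | pc_mulDl s t u : pcong (PMul (PAdd s t) u) (PAdd (PMul s u) (PMul t u))
  | pc_mulDr s t u : pcong (PMul s (PAdd t u)) (PAdd (PMul s t) (PMul s u))
  | pc_mulZl k s t : pcong (PMul (PScale k s) t) (PScale k (PMul s t))
  | pc_mulZr k s t : pcong (PMul s (PScale k t)) (PScale k (PMul s t))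
  | pc_mulA s t u : pcong (PMul s (PMul t u)) (PMul (PMul s t) u)
  | pc_mulCl s t u : pcong (PMul (PMul s t) u) (PMul (PMul t s) u).

Section FreePerm.
Context (K : fieldType) (V : Type).

Definition pcongb : rel (pterm K V) := fun s t => `[< pcong s t >].

Lemma pcongb_refl : reflexive pcongb.
Proof. by move=> s; apply/asboolP/pc_refl. Qed.

Lemma pcongb_sym : symmetric pcongb.
Proof. by move=> s t; apply/idP/idP => /asboolP h; apply/asboolP/pc_sym. Qed.

Lemma pcongb_trans : transitive pcongb.
Proof.
by move=> t s u /asboolP h1 /asboolP h2; apply/asboolP; apply: pc_trans h1 h2.
Qed.

Canonical pcong_equiv := EquivRel pcongb pcongb_refl pcongb_sym pcongb_trans.

Definition freePerm := {eq_quot pcong_equiv}.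
HB.instance Definition _ := Choice.on freePerm.
HB.instance Definition _ := EqQuotient.on freePerm.

Definition pcls (s : pterm K V) : freePerm := \pi_freePerm s.

Lemma pclsP s t : pcls s = pcls t <-> pcong s t.
Proof. by rewrite /pcls; split=> [/eqquotP/asboolP|h]; last exact/eqquotP/asboolP. Qed.

Lemma repr_pcong s : pcong (repr (pcls s)) s.
Proof. by apply/pclsP; rewrite /pcls reprK. Qed.

Lemma pcls_surj (x : freePerm) : exists s, x = pcls s.
Proof. by exists (repr x); rewrite /pcls reprK. Qed.

Definition fp_opp (x : freePerm) := pcls (POpp (repr x)).
Definition fp_add (x y : freePerm) := pcls (PAdd (repr x) (repr y)).
Definition fp_scale k (x : freePerm) := pcls (PScale k (repr x)).
Definition fp_mul (x y : freePerm) := pcls (PMul (repr x) (repr y)).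

Lemma fp_oppE s : fp_opp (pcls s) = pcls (POpp s).
Proof. exact/pclsP/pc_opp/repr_pcong. Qed.

Lemma fp_addE s t : fp_add (pcls s) (pcls t) = pcls (PAdd s t).
Proof. by apply/pclsP/pc_add; apply: repr_pcong. Qed.

Lemma fp_scaleE k s : fp_scale k (pcls s) = pcls (PScale k s).
Proof. exact/pclsP/pc_scale/repr_pcong. Qed.

Lemma fp_mulE s t : fp_mul (pcls s) (pcls t) = pcls (PMul s t).
Proof. by apply/pclsP/pc_mul; apply: repr_pcong. Qed.

Let E := (fp_oppE, fp_addE, fp_scaleE, fp_mulE).

Fact fp_addA : associative fp_add.
Proof.
move=> x y z; have [[s ->] [t ->] [u ->]] := And3 (pcls_surj x) (pcls_surj y) (pcls_surj z).
by rewrite !E; apply/pclsP/pc_addA.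
Qed.

Fact fp_addC : commutative fp_add.
Proof.
move=> x y; have [[s ->] [t ->]] := conj (pcls_surj x) (pcls_surj y).
by rewrite !E; apply/pclsP/pc_addC.
Qed.

Fact fp_add0 : left_id (pcls PZero) fp_add.
Proof. by move=> x; have [s ->] := pcls_surj x; rewrite !E; apply/pclsP/pc_add0. Qed.

Fact fp_addN : left_inverse (pcls PZero) fp_opp fp_add.
Proof. by move=> x; have [s ->] := pcls_surj x; rewrite !E; apply/pclsP/pc_addN. Qed.

HB.instance Definition _ :=
  GRing.isZmodule.Build freePerm fp_addA fp_addC fp_add0 fp_addN.

Fact fp_scaleA k l x : fp_scale k (fp_scale l x) = fp_scale (k * l) x.
Proof. by have [s ->] := pcls_surj x; rewrite !E; apply/pclsP/pc_scaleA. Qed.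

Fact fp_scale1 : left_id 1 fp_scale.
Proof. by move=> x; have [s ->] := pcls_surj x; rewrite !E; apply/pclsP/pc_scale1. Qed.

Fact fp_scaleDr : right_distributive fp_scale +%R.
Proof.
move=> k x y; have [[s ->] [t ->]] := conj (pcls_surj x) (pcls_surj y).
by rewrite /GRing.add /= !E; apply/pclsP/pc_scaleDr.
Qed.

Fact fp_scaleDl x : {morph fp_scale^~ x : k l / k + l}.
Proof.
move=> k l; have [s ->] := pcls_surj x.
by rewrite [in RHS]/GRing.add /= !E; apply/pclsP/pc_scaleDl.
Qed.

HB.instance Definition _ := GRing.Zmodule_isLmodule.Build K freePerm
  fp_scaleA fp_scale1 fp_scaleDr fp_scaleDl.

Lemma pcls_zero : pcls PZero = 0. Proof. by []. Qed.

Lemma pcls_opp s : pcls (POpp s) = - pcls s.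
Proof. exact/esym/fp_oppE. Qed.

Lemma pcls_add s t : pcls (PAdd s t) = pcls s + pcls t.
Proof. exact/esym/fp_addE. Qed.

Lemma pcls_scale k s : pcls (PScale k s) = k *: pcls s.
Proof. exact/esym/fp_scaleE. Qed.

Fact fp_mulDl x y z : fp_mul (x + y) z = fp_mul x z + fp_mul y z.
Proof.
have [[s ->] [t ->] [u ->]] := And3 (pcls_surj x) (pcls_surj y) (pcls_surj z).
by rewrite -pcls_add !fp_mulE -pcls_add; apply/pclsP/pc_mulDl.
Qed.

Fact fp_mulDr x y z : fp_mul x (y + z) = fp_mul x y + fp_mul x z.
Proof.
have [[s ->] [t ->] [u ->]] := And3 (pcls_surj x) (pcls_surj y) (pcls_surj z).
by rewrite -pcls_add !fp_mulE -pcls_add; apply/pclsP/pc_mulDr.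
Qed.

Fact fp_mulZl k x y : fp_mul (k *: x) y = k *: fp_mul x y.
Proof.
have [[s ->] [t ->]] := conj (pcls_surj x) (pcls_surj y).
by rewrite -[k *: pcls s]pcls_scale !fp_mulE -pcls_scale; apply/pclsP/pc_mulZl.
Qed.

Fact fp_mulZr k x y : fp_mul x (k *: y) = k *: fp_mul x y.
Proof.
have [[s ->] [t ->]] := conj (pcls_surj x) (pcls_surj y).
by rewrite -[k *: pcls t]pcls_scale !fp_mulE -pcls_scale; apply/pclsP/pc_mulZr.
Qed.

Fact fp_mulA x y z : fp_mul x (fp_mul y z) = fp_mul (fp_mul x y) z.
Proof.
have [[s ->] [t ->] [u ->]] := And3 (pcls_surj x) (pcls_surj y) (pcls_surj z).
by rewrite !fp_mulE; apply/pclsP/pc_mulA.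
Qed.

Fact fp_mulCl x y z : fp_mul (fp_mul x y) z = fp_mul (fp_mul y x) z.
Proof.
have [[s ->] [t ->] [u ->]] := And3 (pcls_surj x) (pcls_surj y) (pcls_surj z).
by rewrite !fp_mulE; apply/pclsP/pc_mulCl.
Qed.

HB.instance Definition _ := Lmodule_isPermAlgebra.Build K freePerm
  fp_mulDl fp_mulDr fp_mulZl fp_mulZr fp_mulA fp_mulCl.

Lemma pcls_mul s t : pcls (PMul s t) = pcls s ** pcls t.
Proof. exact/esym/fp_mulE. Qed.

Definition pclsE := (pcls_zero, pcls_opp, pcls_add, pcls_scale, pcls_mul).

Section Eval.
Context (A : permAlgType K) (rho : V -> A).

Fixpoint peval (t : pterm K V) : A :=
  match t with
  | PVar v => rho v
  | PZero => 0
  | POpp s => - peval s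
  | PAdd s u => peval s + peval u
  | PScale k s => k *: peval s
  | PMul s u => peval s ** peval u
  end.

Lemma peval_pcong s t : pcong s t -> peval s = peval t.
Proof.
elim=> //= *; try congruence.
- by rewrite addrA.
- by rewrite addrC.
- by rewrite add0r.
- by rewrite addNr.
- by rewrite scalerA.
- by rewrite scale1r.
- by rewrite scalerDr.
- by rewrite scalerDl.
- by rewrite pmulDl.
- by rewrite pmulDr.
- by rewrite pmulZl.
- by rewrite pmulZr.
- by rewrite pmulA.
- by rewrite pmulCl.
Qed.

Definition freePerm_eval (x : freePerm) : A := peval (repr x).

Lemma freePerm_evalE s : freePerm_eval (pcls s) = peval s.
Proof. exact/peval_pcong/repr_pcong. Qed.

Lemma freePerm_eval_linear : linear freePerm_eval.
Proof.
move=> k x y; have [[s ->] [t ->]] := conj (pcls_surj x) (pcls_surj y).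
by rewrite -pcls_scale -pcls_add !freePerm_evalE.
Qed.

Lemma freePerm_evalM : {morph freePerm_eval : x y / x ** y}.
Proof.
move=> x y; have [[s ->] [t ->]] := conj (pcls_surj x) (pcls_surj y).
by rewrite -pcls_mul !freePerm_evalE.
Qed.

End Eval.
End FreePerm.

(* The pair (x, s) is the generator x^(s). *)
Definition derPerm (K : fieldType) (X : Type) := freePerm K (X * nat).
HB.instance Definition _ (K : fieldType) (X : Type) :=
  PermAlgebra.on (derPerm K X).

Section DerPerm.
Context (K : fieldType) (X : Type).

Fixpoint pterm_deriv (t : pterm K (X * nat)) : pterm K (X * nat) :=
  match t with
  | PVar v => PVar (v.1, v.2.+1)
  | PZero => PZero
  | POpp s => POpp (pterm_deriv s)
  | PAdd s u => PAdd (pterm_deriv s) (pterm_deriv u)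
  | PScale k s => PScale k (pterm_deriv s)
  | PMul s u => PAdd (PMul (pterm_deriv s) u) (PMul s (pterm_deriv u))
  end.

Lemma pterm_deriv_pcong s t :
  pcong s t -> pcong (pterm_deriv s) (pterm_deriv t).
Proof.
move=> st; apply/pclsP; elim: st => {s t} /=.
- by [].
- by move=> s t _ ->.
- by move=> s t u _ -> _ ->.
- by move=> s s' _ e; rewrite !pclsE e.
- by move=> s s' t t' _ e _ e'; rewrite !pclsE e e'.
- by move=> k s s' _ e; rewrite !pclsE e.
- by move=> s s' t t' /pclsP h e /pclsP h' e'; rewrite !pclsE e e' h h'.
- by move=> s t u; rewrite !pclsE addrA.
- by move=> s t; rewrite !pclsE addrC.
- by move=> s; rewrite !pclsE add0r.
- by move=> s; rewrite !pclsE addNr.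
- by move=> k l s; rewrite !pclsE scalerA.
- by move=> s; rewrite !pclsE scale1r.
- by move=> k s t; rewrite !pclsE scalerDr.
- by move=> k l s; rewrite !pclsE scalerDl.
- by move=> s t u; rewrite !pclsE !pmulDl addrACA.
- by move=> s t u; rewrite !pclsE !pmulDr addrACA.
- by move=> k s t; rewrite !pclsE !pmulZl scalerDr.
- by move=> k s t; rewrite !pclsE !pmulZr scalerDr.
- by move=> s t u; rewrite !pclsE pmulDr pmulDl !pmulA addrA.
- move=> s t u; rewrite !pclsE !pmulDl (pmulCl (pcls s) (pcls t)).
  by rewrite (pmulCl _ (pcls t)) (pmulCl (pcls s)) (addrC (_ ** _ ** _)).
Qed.

Definition derPerm_deriv (x : derPerm K X) : derPerm K X :=
  pcls (pterm_deriv (repr x)).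

Lemma derPerm_derivE s : derPerm_deriv (pcls s) = pcls (pterm_deriv s).
Proof. exact/pclsP/pterm_deriv_pcong/repr_pcong. Qed.

Fact derPerm_deriv_linear : linear derPerm_deriv.
Proof.
move=> k x y; have [[s ->] [t ->]] := conj (pcls_surj x) (pcls_surj y).
by rewrite -pcls_scale -pcls_add !derPerm_derivE /= !pclsE.
Qed.

Fact derPerm_derivM (x y : derPerm K X) :
  derPerm_deriv (x ** y) = derPerm_deriv x ** y + x ** derPerm_deriv y.
Proof.
have [[s ->] [t ->]] := conj (pcls_surj x) (pcls_surj y).
by rewrite -pcls_mul !derPerm_derivE /= !pclsE.
Qed.

HB.instance Definition _ := PermAlgebra_isDifferential.Build K (derPerm K X)
  derPerm_deriv_linear derPerm_derivM.

Lemma pderiv_pcls s :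
  pderiv (pcls s : derPerm K X) = pcls (pterm_deriv s) :> derPerm K X.
Proof. exact: derPerm_derivE. Qed.

Definition derPerm_gen (x : X) (s : nat) : derPerm K X := pcls (PVar (x, s)).

Lemma pderiv_gen x s : pderiv (derPerm_gen x s) = derPerm_gen x s.+1.
Proof. exact: derPerm_derivE. Qed.

(* Universal property: homomorphisms of differential perm algebras out of     *)
(* DerPerm<X> are the same as substitutions of the variables.                 *)
Theorem derPerm_universal (A : diffPermAlgType K) (a : X -> A) :
  exists! phi : derPerm K X -> A,
    diffPerm_hom phi /\ forall x, phi (derPerm_gen x 0) = a x.
Proof.
pose rho (v : X * nat) : A := iter v.2 pderiv (a v.1).
exists (freePerm_eval rho : derPerm K X -> A); split.
  split; last by move=> x; rewrite freePerm_evalE.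
  split; [exact: freePerm_eval_linear | exact: freePerm_evalM |].
  move=> x; have [s ->] := pcls_surj x.
  rewrite pderiv_pcls !freePerm_evalE; elim: s => //=.
  - by rewrite raddf0.
  - by move=> s ->; rewrite raddfN.
  - by move=> s -> t ->; rewrite raddfD.
  - by move=> k s ->; rewrite linearZ.
  - by move=> s -> t ->; rewrite pderivM.
move=> psi [[lin_psi psiM psiD] psi_gen].
pose psiL := GRing.isLinear.Build K (derPerm K X) A *:%R psi lin_psi.
pose Psi : {linear derPerm K X -> A} := HB.pack psi psiL.
apply/funext => x; have [s ->] := pcls_surj x; rewrite freePerm_evalE.
elim: s => /=.
- case=> y n; rewrite /rho /=; elim: n => [|n IHn]; first exact/esym/psi_gen.
  by rewrite iterS IHn -[LHS]psiD pderiv_gen.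
- exact/esym/(raddf0 Psi).
- by move=> s ->; rewrite pcls_opp; apply/esym/(raddfN Psi).
- by move=> s -> t ->; rewrite pcls_add; apply/esym/(raddfD Psi).
- by move=> k s ->; rewrite pcls_scale; apply/esym/(linearZZ Psi).
- by move=> s -> t ->; rewrite pcls_mul; apply/esym/psiM.
Qed.

End DerPerm.

Definition satisfies_identity (K : fieldType) (X : Type)
    (A : diffPermAlgType K) (f : derPerm K X) : Prop :=
  forall phi : derPerm K X -> A, diffPerm_hom phi -> phi f = 0.

(* Main.v *)
(* Left multiplications in a perm algebra commute, so a perm polynomial f acts
   on A through its commutative image F, and F is nonzero exactly when f is not
   right-annihilating.  Claim: if F(a) b_1' ... b_m' h = 0 holds identically for
   some nonzero F, then b_1' ... b_n' h = 0 holds identically for some n.  Take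
   F homogeneous and induct on its degree.  The part of F(a) linear in a
   variable x is a differential operator y |-> sum_s (dF/dx^(s)) y^(s) which
   vanishes identically; k commutators with multiplications by b_1, ..., b_k,
   where k is its order, give k! (dF/dx^(k)) b_1' ... b_k' y = 0, and dF/dx^(k)
   has lower degree.  By Euler's identity some dF/dx^(k) is nonzero. *)
From HB Require Import structures.
Require Import Defs.
From mathcomp Require Import all_boot all_order all_algebra.
From mathcomp Require Import boolp.
Local Open Scope ring_scope.
Set Implicit Arguments.
Unset Strict Implicit.
Unset Printing Implicit Defensive.
Import GRing.Theory.

(** * Left multiplications in a perm algebra *)

Section PermTheory.
Context (K : fieldType) (A : permAlgType K).

Fact pmul_linear (a : A) : linear (pmul a).
Proof. by move=> k x y; rewrite pmulDr pmulZr. Qed.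

HB.instance Definition _ (a : A) :=
  GRing.isLinear.Build K A A *:%R (pmul a) (pmul_linear a).

Lemma pmul0l (u : A) : 0 ** u = 0.
Proof. by rewrite -[X in X ** _](scale0r 0) pmulZl scale0r. Qed.

Lemma pmulMnl (a u : A) n : (a *+ n) ** u = (a ** u) *+ n.
Proof. by elim: n => [|n IHn]; rewrite ?pmul0l // !mulrS pmulDl IHn. Qed.

Lemma pmul_suml (I : Type) (r : seq I) (P : pred I) (F : I -> A) (u : A) :
  (\sum_(i <- r | P i) F i) ** u = \sum_(i <- r | P i) F i ** u.
Proof.
by apply: (big_morph (fun z => z ** u)) => [x y|]; rewrite ?pmulDl ?pmul0l.
Qed.

Lemma pmulCA (a b u : A) : a ** (b ** u) = b ** (a ** u).
Proof. by rewrite !pmulA pmulCl. Qed.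

Lemma pprod_rcons (s : seq A) (h : A) :
  pprod (rcons s h) = foldr (@pmul K A) h s.
Proof.
case: s => [//|a s] /=; rewrite foldl_rcons.
by elim: s a => [//|b s IHs] a /=; rewrite IHs pmulA -IHs; case: s {IHs}.
Qed.

End PermTheory.

(* The scaling p(2 x) - 2^n p(x) removes the top coefficient of p. *)
Lemma vanishing_coef (K : fieldType) (M : lmodType K) (n : nat) (v : nat -> M) :
    [pchar K] =i pred0 ->
    (forall l : K, \sum_(i < n) l ^+ i *: v i = 0) ->
  forall i, (i < n)%N -> v i = 0.
Proof.
move=> charK0; elim: n v => [//|n IHn] v v0.
have nat_neq0 m : (m.+1%:R : K) != 0 by rewrite ((pcharf0P K).1 charK0).
have low i : (i < n)%N -> v i = 0.
  move=> lt_in; apply: (@scalerI _ _ (2 ^+ i - 2 ^+ n : K)).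
    rewrite -oppr_eq0 opprB -!natrX -natrB; last by rewrite leq_exp2l // ltnW.
    by rewrite -(prednK (n := _ - _)) ?nat_neq0 // subn_gt0 ltn_exp2l.
  rewrite scaler0.
  apply: (IHn (fun i => (2 ^+ i - 2 ^+ n) *: v i)) => // l.
  have := v0 (2 * l); rewrite -[RHS](scaler0 _ (2 ^+ n)) -[in RHS](v0 l).
  rewrite scaler_sumr !big_ord_recr /= scalerA exprMn => /addIr /eqP.
  rewrite -subr_eq0 -sumrB => /eqP e; rewrite -[RHS]e; apply: eq_bigr => j _.
  by rewrite !scalerA exprMn -scalerBl -mulrBl mulrC.
move=> i; rewrite ltnS leq_eqVlt => /predU1P[-> | /low //].
have := v0 1; rewrite big_ord_recr /= big1 => [|j _]; last by rewrite low ?scaler0.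
by rewrite add0r expr1n scale1r.
Qed.

(** * Commutative polynomials acting by left multiplication, and their polarization *)

Section Polynomials.
Context (K : fieldType) (V : eqType).

(* A list of terms (c, w), the scalar c times the monomial w, read as their sum;
   neither the order of the letters of w nor repeated monomials are normalized. *)
Definition cpoly := seq (K * seq V).

Definition wact (A : permAlgType K) (rho : V -> A) (w : seq V) (u : A) : A :=
  foldr (fun v z => rho v ** z) u w.

Definition cact (A : permAlgType K) (rho : V -> A) (F : cpoly) (u : A) : A :=
  \sum_(p <- F) p.1 *: wact rho p.2 u.

(* F = 0 as a commutative polynomial, tested on all perm algebras so that no
   normal form of polynomials is needed. *)
Definition null_cpoly (F : cpoly) : Prop :=
  forall (A : permAlgType K) (rho : V -> A) (u : A), cact rho F u = 0.

Definition homog (d : nat) (F : cpoly) : bool := all (fun p => size p.2 == d) F.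

Definition homog_part (d : nat) (F : cpoly) : cpoly :=
  [seq p <- F | size p.2 == d].

(** Each occurrence of [v] yields its own entry, so the multiplicities of the product rule appear as
    repetitions. *)
Fixpoint wpartial (v : V) (w : seq V) : seq (seq V) :=
  if w is a :: w' then
    (if v == a then [:: w'] else [::]) ++ [seq a :: z | z <- wpartial v w']
  else [::].

Definition cpartial (v : V) (F : cpoly) : cpoly :=
  flatten [seq [seq (p.1, z) | z <- wpartial v p.2] | p <- F].

Fixpoint cpoly_of (t : pterm K V) : cpoly :=
  match t with
  | PVar v => [:: (1, [:: v])]
  | PZero => [::]
  | POpp s => [seq (- p.1, p.2) | p <- cpoly_of s]
  | PAdd s u => cpoly_of s ++ cpoly_of u
  | PScale k s => [seq (k * p.1, p.2) | p <- cpoly_of s]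
  | PMul s u =>
      [seq (p.1 * q.1, p.2 ++ q.2) | p <- cpoly_of s, q <- cpoly_of u]
  end.

Lemma size_wpartial v w z : z \in wpartial v w -> (size z).+1 = size w.
Proof.
elim: w z => [//|a w IHw] z /=; rewrite mem_cat => /orP[|/mapP[y /IHw <- ->] //].
by case: ifP => // _; rewrite inE => /eqP ->.
Qed.

Lemma homog_partial v d F : homog d.+1 F -> homog d (cpartial v F).
Proof.
move=> /allP hF; apply/allP => q /flattenP[_ /mapP[p pF ->]] /mapP[z zp ->] /=.
by rewrite -eqSS (size_wpartial zp) hF.
Qed.

Lemma homog_partP d F : homog d (homog_part d F).
Proof. exact: filter_all. Qed.

Section Action.
Context (A : permAlgType K).
Implicit Types (rho eta : V -> A) (F : cpoly) (w : seq V) (u : A).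

Fact wact_linear rho w : linear (wact rho w).
Proof. by move=> k x y; elim: w => [//|a w IHw] /=; rewrite IHw linearP. Qed.

HB.instance Definition _ rho w :=
  GRing.isLinear.Build K A A *:%R (wact rho w) (wact_linear rho w).

Fact cact_linear rho F : linear (cact rho F).
Proof.
move=> k x y; rewrite /cact scaler_sumr -big_split /=; apply: eq_bigr => p _.
by rewrite linearP scalerDr !scalerA mulrC.
Qed.

HB.instance Definition _ rho F :=
  GRing.isLinear.Build K A A *:%R (cact rho F) (cact_linear rho F).

Lemma wact_pmul rho w a u : wact rho w (a ** u) = a ** wact rho w u.
Proof. by elim: w => [//|b w IHw] /=; rewrite IHw pmulCA. Qed.

Lemma wact_scale rho w l u :
  wact (fun v => l *: rho v) w u = l ^+ size w *: wact rho w u.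
Proof.
elim: w => [|a w IHw] /=; first by rewrite scale1r.
by rewrite IHw pmulZl linearZ scalerA exprS.
Qed.

Lemma cact_cat rho F G u : cact rho (F ++ G) u = cact rho F u + cact rho G u.
Proof. exact: big_cat. Qed.

(** Links perm terms to polynomials: a null image makes every value of [t] right-annihilating. *)
Lemma cact_cpoly_of rho t u : cact rho (cpoly_of t) u = peval rho t ** u.
Proof.
elim: t u => [v||s IHs|s IHs t IHt|k s IHs|s IHs t IHt] u /=.
- by rewrite /cact big_seq1 /= scale1r.
- by rewrite /cact big_nil pmul0l.
- rewrite -scaleN1r pmulZl -IHs /cact big_map scaler_sumr.
  by apply: eq_bigr => p _; rewrite scalerA mulN1r.
- by rewrite cact_cat IHs IHt pmulDl.
- rewrite pmulZl -IHs /cact big_map scaler_sumr.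
  by apply: eq_bigr => p _; rewrite scalerA.
- rewrite -pmulA -IHs -IHt /cact big_allpairs_dep; apply: eq_bigr => p _.
  rewrite linear_sum scaler_sumr; apply: eq_bigr => q _.
  by rewrite /= linearZ /= scalerA /wact foldr_cat.
Qed.

Lemma cact_homog_parts rho F u d :
    (forall p, p \in F -> (size p.2 < d)%N) ->
  cact rho F u = \sum_(i < d) cact rho (homog_part i F) u.
Proof.
move=> ltFd; under eq_bigr do rewrite /cact big_filter big_mkcond.
rewrite exchange_big /cact /= !big_seq; apply: eq_bigr => p /ltFd lt_pd.
rewrite -big_mkcond /= (big_pred1 (Ordinal lt_pd)) // => i.
Qed.

Lemma cact_scale rho d F l u :
  homog d F -> cact (fun v => l *: rho v) F u = l ^+ d *: cact rho F u.
Proof.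
move=> /allP hF; rewrite /cact scaler_sumr !big_seq; apply: eq_bigr => p /hF.
by move=> /eqP <-; rewrite wact_scale !scalerA mulrC.
Qed.

(* The coefficient of l^i in [wact (rho + l eta) w u]. *)
Fixpoint polar rho eta w (i : nat) u : A :=
  if w is a :: w' then
    rho a ** polar rho eta w' i u +
    (if i is j.+1 then eta a ** polar rho eta w' j u else 0)
  else if i is 0 then u else 0.

Lemma polar_oversize rho eta w i u : (size w < i)%N -> polar rho eta w i u = 0.
Proof.
elim: w i => [|a w IHw] [|i] //= lt_wi.
by rewrite !IHw ?linear0 ?addr0 // ltnW.
Qed.

Lemma polar0 rho eta w u : polar rho eta w 0 u = wact rho w u.
Proof. by elim: w => //= a w ->; rewrite addr0. Qed.

Lemma wact_polar rho eta w l u :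
  wact (fun v => rho v + l *: eta v) w u =
  \sum_(i < (size w).+1) l ^+ i *: polar rho eta w i u.
Proof.
elim: w => [|a w IHw]; first by rewrite /= big_ord1 scale1r.
under eq_bigr do rewrite /= scalerDr; rewrite big_split big_ord_recr /=.
rewrite polar_oversize // !linear0 addr0 [X in _ = _ + X]big_ord_recl /= scaler0 add0r.
rewrite IHw pmulDl pmulZl !linear_sum; congr (_ + _).
  by apply: eq_bigr => i _; rewrite linearZ.
by apply: eq_bigr => i _; rewrite linearZ /= scalerA -exprS.
Qed.

(** Product rule: the linear coefficient replaces one letter [v] of [w] by [eta v], and commutation
    moves that factor innermost. *)
Lemma polar1E rho eta (vs : seq V) w u : uniq vs -> {subset w <= vs} ->
  polar rho eta w 1 u =
  \sum_(v <- vs) \sum_(z <- wpartial v w) wact rho z (eta v ** u).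
Proof.
move=> uniq_vs; elim: w => [|a w IHw] sub_w /=.
  by rewrite big1 // => v _; rewrite big_nil.
rewrite IHw => [|b bw]; last by rewrite sub_w // inE bw orbT.
rewrite polar0 linear_sum /=.
under [RHS]eq_bigr do rewrite big_cat big_map /=.
rewrite big_split addrC; congr (_ + _).
  rewrite (bigD1_seq a) ?sub_w ?mem_head //= eqxx big_seq1 wact_pmul.
  by rewrite big1 ?addr0 // => v /negPf ->; rewrite big_nil.
by apply: eq_bigr => v _; rewrite linear_sum.
Qed.

Lemma cact_cpartial rho v F u :
  cact rho (cpartial v F) u =
  \sum_(p <- F) p.1 *: \sum_(z <- wpartial v p.2) wact rho z u.
Proof.
rewrite /cact big_flatten big_map; apply: eq_bigr => p _.
by rewrite big_map scaler_sumr.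
Qed.

Lemma cpolar1E rho eta (vs : seq V) F u :
    uniq vs -> (forall p, p \in F -> {subset p.2 <= vs}) ->
  \sum_(p <- F) p.1 *: polar rho eta p.2 1 u =
  \sum_(v <- vs) cact rho (cpartial v F) (eta v ** u).
Proof.
move=> uniq_vs sub_F; under [RHS]eq_bigr do rewrite cact_cpartial.
rewrite exchange_big !big_seq; apply: eq_bigr => p /sub_F sub_p.
by rewrite (polar1E _ _ _ uniq_vs sub_p) scaler_sumr.
Qed.

Lemma polar1_diag rho w u : polar rho rho w 1 u = wact rho w u *+ size w.
Proof. by elim: w => [//|a w /= ->]; rewrite polar0 raddfMn mulrSr. Qed.

(** Along the line [rho + l eta] a form of degree [d + 1] has [d + 2] coefficients in [l]; all of
    them vanish, in particular the linear one. *)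
Lemma cact_linear_part rho eta d F u :
    [pchar K] =i pred0 -> homog d.+1 F ->
    (forall l, cact (fun v => rho v + l *: eta v) F u = 0) ->
  \sum_(p <- F) p.1 *: polar rho eta p.2 1 u = 0.
Proof.
move=> charK0 /allP hF F0.
apply: (@vanishing_coef K A d.+2
  (fun i => \sum_(p <- F) p.1 *: polar rho eta p.2 i u)) => // l.
under eq_bigr do rewrite scaler_sumr.
rewrite exchange_big -[RHS](F0 l) /cact !big_seq; apply: eq_bigr => p /hF /eqP hp.
rewrite wact_polar hp scaler_sumr; apply: eq_bigr => i _.
by rewrite !scalerA mulrC.
Qed.

End Action.

(* Euler's identity: (d + 1) F is the sum of the v * dF/dv. *)
Lemma null_cpoly_euler d (vs : seq V) F :
    [pchar K] =i pred0 -> homog d.+1 F ->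
    uniq vs -> (forall p, p \in F -> {subset p.2 <= vs}) ->
    (forall v, v \in vs -> null_cpoly (cpartial v F)) ->
  null_cpoly F.
Proof.
move=> charK0 /allP hF uniq_vs sub_F F0 A rho u.
apply: (@scalerI _ _ (d.+1%:R : K)); first by rewrite ((pcharf0P K).1 charK0).
rewrite scaler0 scaler_nat; have := cpolar1E rho rho u uniq_vs sub_F.
rewrite [in RHS]big_seq [in RHS]big1 => [<-|v /F0 -> //].
rewrite /cact -sumrMnl !big_seq; apply: eq_bigr => p /hF /eqP hp.
by rewrite polar1_diag hp scalerMnr.
Qed.

Lemma null_homog_parts F :
  (forall d, null_cpoly (homog_part d F)) -> null_cpoly F.
Proof.
move=> F0 A rho u.
rewrite (@cact_homog_parts _ _ _ _ (\max_(p <- F) size p.2).+1).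
  by rewrite big1 // => i _; apply: F0.
  by move=> p pF; exact: (@leq_bigmax_seq _ _ xpredT (fun p => size p.2) p pF isT).
Qed.

End Polynomials.

(** * Linear differential operators on a differential perm algebra *)

Section Derivations.
Context (K : fieldType) (A : diffPermAlgType K).

(** The values of the generators x^(s) under the homomorphism extending [a]. *)
Definition jet (a : nat -> A) (v : nat * nat) : A := iter v.2 pderiv (a v.1).

(** The tail [h] makes up for the missing unit: the empty product acts as the identity. *)
Definition deriv_prod (bs : seq A) (h : A) : A :=
  foldr (fun b z => pderiv b ** z) h bs.

Lemma deriv_prod_pmul bs b h : deriv_prod bs (b ** h) = b ** deriv_prod bs h.
Proof. by elim: bs => //= c bs ->; rewrite pmulCA. Qed.

Lemma iter_pderiv_linear s : linear (iter s (@pderiv K A)).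
Proof. by move=> k x y; elim: s => //= s ->; rewrite linearP. Qed.

(** The bound [N] is free so that the sums for different [s] share one index range; terms with
    [i > s] have a zero binomial coefficient. *)
Lemma leibniz N s (b y : A) : (s < N)%N ->
  iter s pderiv (b ** y) =
  \sum_(i < N) (iter (s - i) pderiv b ** iter i pderiv y) *+ 'C(s, i).
Proof.
elim: s N => [|s IHs] [|N] // lt_sN.
  by rewrite big_ord_recl /= big1 ?addr0 // => i _; rewrite bin0n mulr0n.
rewrite iterS (IHs N.+1 (ltnW lt_sN)) raddf_sum /=.
under eq_bigr do rewrite raddfMn /= pderivM mulrnDl.
rewrite big_split /= [X in _ + X]big_ord_recr /= bin_small // addr0.
rewrite !big_ord_recl /= -addrA; congr (_ + _); first by rewrite !bin0 !subn0.
rewrite -big_split; apply: eq_bigr => i _ /=; rewrite /bump /= !add1n subSS.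
rewrite binS mulrnDr; congr (_ + _).
(* For [s <= i] the truncated exponents disagree, but then ['C(s, i.+1)] is zero. *)
have [le_is|lt_si] := ltnP i s; first by rewrite -iterS -subSn.
by rewrite bin_small.
Qed.

(* Passing from y to the commutator with multiplication by b lowers the order
   by one and replaces the top coefficient T_(k+1) by (k+1) T_(k+1) b'. *)
Lemma top_coefficient_vanishes (U : A -> Prop) k (T : nat -> {linear A -> A}) :
    [pchar K] =i pred0 ->
    (forall b u, U u -> U (b ** u)) ->
    (forall y u, U u -> \sum_(s < k.+1) T s (iter s pderiv y ** u) = 0) ->
  forall bs y u, size bs = k -> U u -> T k (deriv_prod bs (y ** u)) = 0.
Proof.
move=> charK0 UM; elim: k T => [|k IHk] T T0 bs y u size_bs Uu.
  by case: bs size_bs => // _; have := T0 y u Uu; rewrite big_ord1.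
case: bs size_bs => // b bs [size_bs].
(* The coefficient of the [i]-th derivative of [y] in the commutator with multiplication by [b], by
   the Leibniz rule; the terms [s = i] cancel. *)
pose T' i z :=
  \sum_(s < k.+2 | (i < s)%N) T s (iter (s - i) pderiv b ** z) *+ 'C(s, i).
have linT' i : linear (T' i).
  move=> c x z; rewrite scaler_sumr -big_split; apply: eq_bigr => s _.
  by rewrite linearP linearP mulrnDl scalerMnr.
pose lT' i : {linear A -> A} :=
  HB.pack (T' i) (GRing.isLinear.Build K A A *:%R (T' i) (linT' i)).
have : lT' k (deriv_prod bs (y ** u)) = 0.
  apply: (IHk lT' _ bs y u size_bs Uu) => {size_bs Uu} {}y {}u Uu.
  (* The commutator is the identity at [b ** y] and [u] minus the one at [y] and [b ** u]; the
     latter is available since [U] is stable under left multiplication. *)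
  have := T0 (b ** y) u Uu; rewrite -[RHS](T0 y (b ** u) (UM _ _ Uu)).
  move/eqP; rewrite -subr_eq0 -sumrB => /eqP eq0; rewrite -[RHS]eq0 {eq0}.
  under eq_bigr => i _ do rewrite /= /T' big_mkcond.
  rewrite exchange_big /=.
  apply: eq_bigr => s _ /=; rewrite -big_mkcond /=.
  rewrite (@leibniz k.+2) // pmul_suml linear_sum /=.
  rewrite (bigD1 s) //= subnn binn mulr1n addrC.
  have -> : b ** iter s pderiv y ** u = iter s pderiv y ** (b ** u).
    by rewrite pmulCl pmulA.
  rewrite addrK.
  (* The index [k.+1] drops out, being either the cancelled [i = s] or larger than [s]; so the
     commutator has order at most [k]. *)
  rewrite [RHS]big_mkcond big_ord_recr /= [X in _ = _ + X](_ : _ = 0) ?addr0.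
    rewrite [LHS]big_mkcond; apply: eq_bigr => i _ /=.
    rewrite -val_eqE /= pmulMnl -pmulA raddfMn.
    by case: ltngtP => // lt_si; rewrite bin_small.
  have := ltn_ord s; rewrite ltnS leq_eqVlt -val_eqE /= eq_sym.
  by case: eqP => //= _ lt_sk; rewrite bin_small // pmul0l linear0.
(* Only [s = k.+1] contributes to [T' k], with binomial coefficient [k.+1] and one derivative of
   [b]. *)
rewrite {1}/lT' /= /T' big_mkcond big_ord_recr /= big1 ?add0r => [|s _]; last first.
  by rewrite ltnNge -ltnS ltn_ord.
rewrite ltnSn subSnn binSn -scaler_nat => top0.
apply: (@scalerI _ _ (k.+1%:R : K)); first by rewrite ((pcharf0P K).1 charK0).
by rewrite scaler0.
Qed.

End Derivations.

(** * Lowering the degree of an identity *)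

Section Identities.
Context (K : fieldType) (charK0 : [pchar K] =i pred0) (A : diffPermAlgType K).

(** The identity is only asked for after [m] derivative factors, because each passage to a partial
    derivative costs such factors. *)
Definition kills_deriv_prods (m : nat) (F : cpoly K (nat * nat)%type) : Prop :=
  forall (a : nat -> A) bs h, size bs = m ->
    cact (jet a) F (deriv_prod bs h) = 0.

(** A finite grid of letters x^(s), built as a product so that sums over it split by variable and by
    order. *)
Definition square (N : nat) : seq (nat * nat) :=
  [seq (x, s) | x <- index_iota 0 N, s <- index_iota 0 N].

Lemma mem_square N v : (v \in square N) = (v.1 < N)%N && (v.2 < N)%N.
Proof.
rewrite -[(v.1 < N)%N](mem_index_iota 0 N) -[(v.2 < N)%N](mem_index_iota 0 N).
apply/allpairsP/andP => [[[x s] /= [xN sN ->]] //|].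
by move=> [xN sN]; exists v => /=; split=> //; case: (v).
Qed.

Lemma square_uniq N : uniq (square N).
Proof. by rewrite allpairs_uniq ?iota_uniq // => -[? ?] [? ?]. Qed.

(** Euler's identity yields a non-null partial derivative; for its variable [x], take the largest
    order [k] with a non-null one. *)
Lemma exists_leading_partial d (F : cpoly K (nat * nat)%type) :
    homog d.+1 F -> ~ null_cpoly F ->
  exists N x k, [/\ forall p, p \in F -> {subset p.2 <= square N},
    ~ null_cpoly (cpartial (x, k) F), (x < N)%N, (k < N)%N &
    forall s, (k < s < N)%N -> null_cpoly (cpartial (x, s) F)].
Proof.
move=> hF F_neq0.
pose N := (\max_(p <- F) \max_(v <- p.2) maxn v.1 v.2).+1.
have sub_F p : p \in F -> {subset p.2 <= square N}.
  move=> pF v vp; rewrite mem_square -gtn_max ltnS.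
  apply: leq_trans (@leq_bigmax_seq _ _ xpredT (fun v => maxn v.1 v.2) v vp isT) _.
  exact: (@leq_bigmax_seq _ _ xpredT (fun p => \max_(v <- p.2) maxn v.1 v.2)).
have [[x s] xs_sq dF_neq0] :
    exists2 v, v \in square N & ~ null_cpoly (cpartial v F).
  apply: contrapT => no_v; apply: F_neq0.
  apply: (null_cpoly_euler charK0 hF (square_uniq N) sub_F) => v v_sq.
  by apply: contrapT => dF_neq0; apply: no_v; exists v.
move: xs_sq; rewrite mem_square /= => /andP[lt_xN lt_sN].
pose P s := (s < N)%N && `[< ~ null_cpoly (cpartial (x, s) F) >].
have exP : exists s, P s by exists s; rewrite /P lt_sN; apply/asboolP.
have leP t : P t -> (t <= N)%N by case/andP => /ltnW.
have [k /andP[lt_kN /asboolP k_neq0] k_max] := ex_maxnP exP leP.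
exists N, x, k; split=> // t /andP[lt_kt lt_tN]; apply: contrapT => t_neq0.
move: lt_kt; rewrite ltnNge k_max // /P lt_tN; exact/asboolP.
Qed.

Lemma kills_deriv_prods_partial d m F :
    homog d.+1 F -> ~ null_cpoly F -> kills_deriv_prods m F ->
  exists v n, ~ null_cpoly (cpartial v F) /\ kills_deriv_prods n (cpartial v F).
Proof.
move=> hF F_neq0 F0.
have [N [x [k [sub_F k_neq0 lt_xN lt_kN k_max]]]] :=
  exists_leading_partial hF F_neq0.
(* Of these derivatives, [k] come from the commutators, [m] feed the hypothesis on [F], and the
   first takes the place of [y]. *)
exists (x, k), (k + m).+1; split=> // a [//|b bs] h [size_bs].
rewrite -[bs](cat_take_drop k) /deriv_prod /= foldr_cat -/(deriv_prod _ _).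
rewrite -/(deriv_prod _ _) -deriv_prod_pmul.
pose U u := exists bs (h : A), size bs = m /\ u = deriv_prod bs h.
pose T s : {linear A -> A} := cact (jet a) (cpartial (x, s) F).
have -> : cact (jet a) (cpartial (x, k) F) = T k by [].
apply: (@top_coefficient_vanishes _ _ U) => //.
- move=> c _ [cs [g [size_cs ->]]]; exists cs, (c ** g); split=> //.
  by rewrite deriv_prod_pmul.
- move=> y _ [cs [g [size_cs ->]]]; set u := deriv_prod cs g.
  (* Only the variable [x] moves, in direction [y], so the linear part of [F] is the operator with
     coefficients [T s]. *)
  pose e i := if i == x then y else 0.
  have jetD l : (fun v => jet a v + l *: jet e v) = jet (fun i => a i + l *: e i).
    by apply/funext => v; rewrite /jet addrC [in RHS]addrC iter_pderiv_linear.
  have := @cact_linear_part _ _ _ (jet a) (jet e) _ F u charK0 hF.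
  rewrite (cpolar1E _ _ _ (square_uniq N) sub_F) big_allpairs_dep /=.
  have eta0 i : i != x -> \sum_(s <- index_iota 0 N)
      cact (jet a) (cpartial (i, s) F) (jet e (i, s) ** u) = 0.
    move=> /negPf ix; apply: big1 => s _; rewrite /jet /e /= ix.
    suff -> : iter s (@pderiv K A) 0 = 0 by rewrite pmul0l linear0.
    by elim: s => //= s ->; rewrite linear0.
  rewrite (bigD1_seq x) ?mem_index_iota ?iota_uniq //= [X in _ + X]big1 //.
  rewrite addr0 (big_cat_nat (n := k.+1)) //= [X in _ + X]big_nat.
  rewrite [X in _ + X]big1 => [|s /k_max -> //].
  rewrite addr0 big_mkord /jet /e /= eqxx; apply=> l.
  by rewrite jetD F0.
- by rewrite size_take size_bs; case: ltngtP (leq_addr m k) => // ->.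
- by exists (drop k bs), h; rewrite size_drop size_bs addKn.
Qed.

Lemma deriv_prod_eq0 d m F :
    homog d F -> ~ null_cpoly F -> kills_deriv_prods m F ->
  exists n, forall (bs : seq A) h, size bs = n -> deriv_prod bs h = 0.
Proof.
elim: d m F => [|d IHd] m F hF F_neq0 F0.
  (* In degree 0 every word is empty, so [F] acts as the scalar [c], nonzero because [F] is not
     null. *)
  pose c := \sum_(p <- F) p.1.
  have actE (B : permAlgType K) (rho : _ -> B) u : cact rho F u = c *: u.
    rewrite /cact scaler_suml !big_seq; apply: eq_bigr => p pF.
    by have /size0nil -> : size p.2 = 0%N by apply/eqP/(allP hF).
  exists m => bs h size_bs; have /eqP := F0 (fun=> 0) bs h size_bs.
  rewrite actE scaler_eq0 => /orP[/eqP c0 | /eqP //].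
  by case: F_neq0 => B rho u; rewrite actE c0 scale0r.
have [v [n [G_neq0 G0]]] := kills_deriv_prods_partial hF F_neq0 F0.
exact: IHd (homog_partial v hF) G_neq0 G0.
Qed.

End Identities.

Theorem theorem3p1 (K : fieldType) (charK0 : [pchar K] =i pred0)
    (A : diffPermAlgType K) (f : derPerm K nat)
    (f_nontrivial : ~ annR f) (A_sat_f : satisfies_identity A f) :
  exists2 m : nat, (2 <= m)%N &
    forall a : 'I_m -> A, pprod [seq pderiv (a i) | i <- enum 'I_m] = 0.
Proof.
pose F : cpoly K (nat * nat)%type := cpoly_of (repr f).
have F_neq0 : ~ null_cpoly F.
  move=> F0; apply: f_nontrivial => b.
  (* Nullity is tested on the generic substitution in the free algebra, where [F] acts as left
     multiplication by [f]. *)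
  have := F0 _ (fun v => pcls (PVar v) : derPerm K nat) b; rewrite cact_cpoly_of.
  suff -> : peval (fun v => pcls (PVar v) : derPerm K nat) (repr f) = f by [].
  rewrite -[RHS]reprK -/(pcls _).
  by elim: (repr f) => //= [s ->|s -> t ->|k s ->|s -> t ->]; rewrite !pclsE.
(* With [phi] the homomorphism extending [a], [F] acts as left multiplication by [phi f], which is
   zero. *)
have F0 (a : nat -> A) u : cact (jet a) F u = 0.
  have [phi [[phi_hom phi_gen] _]] := derPerm_universal a.
  rewrite cact_cpoly_of -[RHS](pmul0l u) -(A_sat_f phi phi_hom); congr (_ ** u).
  have [phi_linear phiM phiD] := phi_hom.
  pose Phi : {linear derPerm K nat -> A} :=
    HB.pack phi (GRing.isLinear.Build K (derPerm K nat) A *:%R phi phi_linear).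
  rewrite -[in RHS](reprK f) -/(pcls _).
  elim: (repr f) => [[x s]||s IHs|s IHs t IHt|k s IHs|s IHs t IHt] /=.
  - rewrite /jet /= -phi_gen -[PVar _]/(PVar (x, s)).
    by elim: s => //= s ->; rewrite -phiD pderiv_gen.
  - exact/esym/(raddf0 Phi).
  - by rewrite IHs pcls_opp; apply/esym/(raddfN Phi).
  - by rewrite IHs IHt pcls_add; apply/esym/(raddfD Phi).
  - by rewrite IHs pcls_scale; apply/esym/(linearZZ Phi).
  - by rewrite IHs IHt pcls_mul; apply/esym/phiM.
have [d Fd_neq0] : exists d, ~ null_cpoly (homog_part d F).
  apply: contrapT => no_d; apply: F_neq0; apply: null_homog_parts => d.
  by apply: contrapT => Fd_neq0; apply: no_d; exists d.
have Fd0 : kills_deriv_prods A 0 (homog_part d F).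
  (* Scaling [a] by [l] separates the degrees; [N] exceeds [d] and every degree in [F], so no
     homogeneous part is lost. *)
  move=> a bs h _; pose N := maxn d.+1 (\max_(p <- F) size p.2).+1.
  have lt_dN : (d < N)%N by rewrite leq_maxl.
  apply: (@vanishing_coef K A N
    (fun i => cact (jet a) (homog_part i F) (deriv_prod bs h))) lt_dN => // l.
  rewrite -[RHS](F0 (fun i => l *: a i) (deriv_prod bs h)).
  have -> : jet (fun i => l *: a i) = fun v => l *: jet a v.
    apply/funext => -[x s]; rewrite /jet /=.
    by elim: s => //= s ->; rewrite linearZ.
  rewrite (@cact_homog_parts _ _ _ _ _ _ N) => [|p pF].
    by apply: eq_bigr => i _; rewrite (cact_scale _ _ _ (homog_partP _ _)).
  apply: leq_trans (leq_maxr _ _); rewrite ltnS.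
  exact: (@leq_bigmax_seq _ _ xpredT (fun p => size p.2) p pF isT).
have [n n0] := deriv_prod_eq0 charK0 (homog_partP d F) Fd_neq0 Fd0.
(* The last factor serves as the tail, the first is split off, and the [n] between them give zero;
   this also secures [2 <= m]. *)
exists n.+2 => // a; rewrite enum_ordSr map_rcons pprod_rcons -map_comp.
pose bs := [seq a (widen_ord (leqnSn n.+1) i) | i <- enum 'I_n.+1].
set s := [seq _ | _ <- _]; have -> : s = [seq pderiv b | b <- bs].
  by rewrite /s /bs -!map_comp.
have : size bs = n.+1 by rewrite size_map size_enum_ord.
case: bs => // b bs [size_bs]; rewrite foldr_map /= -/(deriv_prod _ _).
by rewrite n0 ?linear0.
Qed.
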